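(* Let $\mu_X$ be a compactly supported probability measure on $[0,+\infty)$, not equal to the Dirac mass at zero, and let $b$ be the supremum of its support. Assume that $\mu_X$ has a density $f_{\mu_X}$ with a power decay at $b$, i.e. that, as $t\to b$ with $t<b$, $f_{\mu_X}(t)\sim c\,(b-t)^\alpha$ for some exponent $\alpha>-1$ and some constant $c>0$. Then $$T_{\mu_X}(b^+)<\infty\iff\alpha>0\qquad\text{and}\qquad T_{\mu_X}'(b^+)=-\infty\iff\alpha\le1.$$ In particular, if $\alpha=1/2$, then $T_{\mu_X}(b^+)<\infty$ and $T_{\mu_X}'(b^+)=-\infty$.
   Context: $T_{\mu_X}(z)=\int\frac{t}{z-t}\,d\mu_X(t)$ for $z\notin\operatorname{supp}\mu_X$ is the $T$-transform of $\mu_X$. For a function $f$ and $c\in\mathbb{R}$, $f(c^+)=\lim_{z\downarrow c}f(z)$. The notation $f(t)\sim g(t)$ means $f(t)/g(t)\to1$. *)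

(* Defs.v *)
From mathcomp Require Export all_boot all_order all_algebra.
From mathcomp Require Export all_classical all_reals all_analysis.
Export Order.TTheory GRing.Theory Num.Theory numFieldNormedType.Exports.

Set Implicit Arguments.
Unset Strict Implicit.
Unset Printing Implicit Defensive.

Local Open Scope classical_set_scope.
Local Open Scope ring_scope.

(* Topological support of a Borel measure on the line. The interior of [U] is
   used because a neighbourhood [U] itself need not be measurable. *)
Definition msupport (R : realType)
    (mu : {measure set (measurableTypeR R) -> \bar R}) : set R :=
  [set x | forall U : set R, nbhs x U -> (0 < mu (interior U))%E].

(* [mu] is absolutely continuous with density [f] with respect to Lebesgue
   measure. *)
Definition has_density (R : realType)
    (mu : {measure set (measurableTypeR R) -> \bar R}) (f : R -> R) : Prop :=
  [/\ measurable_fun [set: R] f, (forall t, 0 <= f t) &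
      forall A : set (measurableTypeR R), measurable A ->
        mu A = (\int[@lebesgue_measure R]_(t in A) (f t)%:E)%E].

(* Only meaningful for [z] outside the support of [mu], where the integrand is
   bounded on the support. *)
Definition T_transform (R : realType)
    (mu : {measure set (measurableTypeR R) -> \bar R}) (z : R) : R :=
  (\int[mu]_t (t / (z - t)))%R.

(* f(c^+), as an extended real since it may be infinite. [lim] is total, so
   [right_lim f c] is only meaningful together with [has_right_lim f c]. *)
Definition has_right_lim (R : realType) (f : R -> R) (c : R) : Prop :=
  cvg ((f z)%:E @[z --> c^'+]).

Definition right_lim (R : realType) (f : R -> R) (c : R) : \bar R :=
  lim ((f z)%:E @[z --> c^'+]).

(* Main.v *)
Require Import Defs.
From mathcomp Require Import ring lra.
From mathcomp Require Import measurable_realfun.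

(** Write [S k z] for the integral of [t / (z - t) ^ k] against [mu]. The
    hypotheses force [mu] to live on [[0, b[]: it does not charge the complement
    of its support, it has no atoms, and [b > 0] because [f] is positive just
    to the left of [b] whereas [mu] does not charge the negative half-line.
    On that set all the integrands are nonnegative for [z >= b].

    For [z > b] the integrands are bounded, so that [T = S 1] may be
    differentiated under the integral sign, and [T' = - S 2]. As [z] decreases
    to [b] the integrands increase, so by monotone convergence [S k z] tends to
    [S k b] in the extended reals ([cvg_integral_Tkernel]). Both one-sided
    limits therefore exist, and both equivalences are instances, for [k = 1] and
    [k = 2], of a single one:

      [S k b] is finite iff [k < alpha + 1]    ([integral_Tkernel_lty]).

    Away from [b] the integrand of [S k b] is bounded. Close to [b] one has
    [b / 2 <= t <= b], and [f t] lies between constant multiples of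
    [(b - t) ^ alpha], so that [S k b] is finite exactly when
    [(b - t) ^ (alpha - k)] is Lebesgue integrable at [b], that is, when
    [alpha - k > -1] ([integral_powR_subl_lty]). *)

Set Implicit Arguments.
Unset Strict Implicit.
Unset Printing Implicit Defensive.

Local Open Scope classical_set_scope.
Local Open Scope ring_scope.

(** * Measures, supports and densities *)

(** Every point outside the support lies in a null open set, hence in a null
    interval with rational endpoints, and there are countably many of these. *)
Lemma negligible_setC_msupport (R : realType)
    (mu : {measure set (measurableTypeR R) -> \bar R}) :
  mu.-negligible (~` msupport mu).
Proof.
pose I (pq : rat * rat) : set R := `]ratr pq.1, ratr pq.2[%classic.
(* the null rational intervals, enumerated by [nat] *)
pose F n : set R := if unpickle n is Some pq then
   if mu (I pq) == 0%E then I pq else set0 else set0.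
have F0 n : mu.-negligible (F n).
  rewrite /F; case: unpickle => [pq|]; last exact: negligible_set0.
  case: ifPn => [/eqP I0|_]; last exact: negligible_set0.
  by apply/negligibleP => //; exact: measurable_itv.
apply: negligibleS (negligible_bigcup F0).
move=> x /existsNP[U] /not_implyP[/= /nbhs_interior xU /negP].
rewrite -leNgt => muU.
move: (xU); rewrite -nbhs_ballE => -[e /= e0 eU].
have [p /[!in_itv]/= /andP[xp px]] : exists p : rat, ratr p \in `](x - e), x[%R.
  by apply: rat_in_itvoo; rewrite ltrBlDr ltrDl.
have [q /[!in_itv]/= /andP[xq qx]] : exists q : rat, ratr q \in `]x, (x + e)[%R.
  by apply: rat_in_itvoo; rewrite ltrDl.
have := pickleK (p, q); move: (pickle _) => n nK.
exists n; first exact: Logic.I.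
rewrite /F nK ifT; last first.
  rewrite -measure_le0; apply: le_trans muU; apply: le_measure; rewrite ?inE.
  - exact: measurable_itv.
  - by apply: open_measurable; exact: open_interior.
  - move=> y; rewrite /I/= in_itv/= => /andP[py yq]; apply: eU.
    by rewrite /ball/= ltr_distlC (lt_trans xp py) (lt_trans yq qx).
by rewrite /I/= in_itv/= px xq.
Qed.

(** Compactness bounds the support, so that [sup] is a genuine upper bound. *)
Lemma measure_gt_sup_msupport (R : realType)
    (mu : {measure set (measurableTypeR R) -> \bar R}) :
  compact (msupport mu) -> mu `]sup (msupport mu), +oo[%classic = 0%E.
Proof.
move=> cmu; apply/negligibleP; first exact: measurable_itv.
apply: negligibleS (negligible_setC_msupport mu).
move=> x/=; rewrite in_itv/= andbT => bx sx; move: bx; apply/negP.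
rewrite -leNgt; apply: sup_upper_bound => //; split; first by exists x.
have [M [_ sM]] := compact_bounded cmu.
exists (M + 1) => y sy; apply: le_trans (ler_norm _) _.
by apply: sM sy; rewrite ltrDl.
Qed.

Lemma density_dominates (R : realType)
    (mu : {measure set (measurableTypeR R) -> \bar R}) (f : R -> R) :
  has_density mu f -> mu `<< @lebesgue_measure R.
Proof.
move=> [mf f0 muf]; apply/null_content_dominatesP => A mA A0.
rewrite muf// (null_set_integral _ _ A0)//.
exact/measurable_EFinP/measurable_funTS.
Qed.

(** [f] is a version of the Radon-Nikodym derivative of [mu], for which the
    change of variables holds; two densities agree almost everywhere. *)
Lemma ge0_integral_density (R : realType)
    (mu : {finite_measure set (measurableTypeR R) -> \bar R}) (f : R -> R)
    (E : set (measurableTypeR R)) (g : R -> \bar R) :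
  has_density mu f -> measurable E -> measurable_fun E g ->
  (forall t, E t -> 0 <= g t)%E ->
  (\int[mu]_(t in E) g t = \int[@lebesgue_measure R]_(t in E) (g t * (f t)%:E))%E.
Proof.
move=> fd mE mg g0; have domf := density_dominates fd.
case: (fd) => mf f0 muf.
have mf' A : measurable_fun A (EFin \o f).
  exact/measurable_EFinP/measurable_funTS.
pose h := Radon_Nikodym_SigmaFinite.f mu (@lebesgue_measure R).
have ih : lebesgue_measure.-integrable E h.
  by apply: integrableS (Radon_Nikodym_SigmaFinite.f_integrable domf).
(* unlike [g], its absolute value is nonnegative outside [E] as well *)
transitivity (\int[mu]_(t in E) `|g t|)%E.
  by apply: eq_integral => t /[!inE] Et; rewrite gee0_abs ?g0.
rewrite -(Radon_Nikodym_SigmaFinite.change_of_variables domf)//; last first.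
  by apply: measurableT_comp.
transitivity (\int[@lebesgue_measure R]_(t in E) (g t * h t))%E.
  by apply: eq_integral => t /[!inE] Et; rewrite gee0_abs ?g0.
apply: ae_eq_integral => //.
- by apply: emeasurable_funM => //; exact: measurable_int ih.
- by apply: emeasurable_funM => //; exact: mf'.
- apply: ae_eqe_mul2l; apply: integral_ae_eq => // [|A AE mA]; first exact: mf'.
  rewrite -[RHS]muf//.
  by rewrite -(Radon_Nikodym_SigmaFinite.f_integral domf).
Qed.

(** * Integrability of powers at an endpoint *)

Lemma FTC2_is_derive (R : realType) (f F : R -> R) (u v : R) :
  u < v -> {in `[u, v], continuous f} ->
  (forall t, u <= t <= v -> is_derive t 1 F (f t)) ->
  (\int[@lebesgue_measure R]_(t in `[u, v]) (f t)%:E = (F v)%:E - (F u)%:E)%E.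
Proof.
move=> uv cf dF.
have cF t : u <= t <= v -> F x @[x --> t] --> F t.
  by move=> /dF dFt; apply: differentiable_continuous; apply/derivable1_diffP.
apply: continuous_FTC2 => //.
- apply: continuous_in_subspaceT => t /[!inE]; exact: cf.
- split.
  + by move=> t /[!in_itv]/= /andP[ut tv]; apply: ex_derive; apply: dF; rewrite !ltW.
  + by apply: cvg_at_right_filter; apply: cF; rewrite lexx ltW.
  + by apply: cvg_at_left_filter; apply: cF; rewrite lexx ltW.
- move=> t /[!in_itv]/= /andP[ut tv]; rewrite derive1E.
  by have dFt := dF t; apply: derive_val; apply: dFt; rewrite !ltW.
Qed.

Lemma is_derive_subl (R : realType) (b t : R) :
  is_derive t 1 (fun s : R => b - s) (-1).
Proof.
have -> : (fun s : R => b - s) = cst b - id by [].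
by rewrite -[X in is_derive _ _ _ X]sub0r; apply: is_deriveB.
Qed.

Lemma is_derive_powR_subl (R : realType) (b beta t : R) : t < b ->
  is_derive t 1 (fun s => (b - s) `^ beta) (- (beta * (b - t) `^ (beta - 1))).
Proof.
rewrite -subr_gt0 => bt0.
have := @is_derive1_comp _ (fun x : R => x `^ beta) (fun s : R => b - s) _ _ _
  (is_derive1_powR beta bt0) (is_derive_subl b t).
by rewrite mulrN1.
Qed.

Lemma is_derive_ln_subl (R : realType) (b t : R) : t < b ->
  is_derive t 1 (fun s => ln (b - s)) (- (b - t)^-1).
Proof.
rewrite -subr_gt0 => bt0.
have := @is_derive1_comp _ (@ln R) (fun s : R => b - s) _ _ _
  (is_derive1_ln bt0) (is_derive_subl b t).
by rewrite mulrN1.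
Qed.

Lemma continuous_powR_subl (R : realType) (b beta t : R) : t < b ->
  {for t, continuous (fun s => (b - s) `^ beta)}.
Proof.
move=> tb; apply: differentiable_continuous; apply/derivable1_diffP.
by apply: ex_derive; exact: is_derive_powR_subl.
Qed.

Lemma integral_powR_subl (R : realType) (b beta u v : R) :
  u < v < b -> beta != -1 ->
  (\int[@lebesgue_measure R]_(t in `[u, v]) ((b - t) `^ beta)%:E =
   (((b - u) `^ (beta + 1) - (b - v) `^ (beta + 1)) / (beta + 1))%:E)%E.
Proof.
move=> /andP[uv vb] beta1.
have b1 : beta + 1 != 0 by rewrite addr_eq0.
have dF t : u <= t <= v ->
    is_derive t 1 (- (beta + 1)^-1 *: (fun s => (b - s) `^ (beta + 1)))
      ((b - t) `^ beta).
  move=> /andP[ut tv]; have tb := le_lt_trans tv vb.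
  rewrite [X in is_derive _ _ _ X](_ : _ =
    - (beta + 1)^-1 *: - ((beta + 1) * (b - t) `^ (beta + 1 - 1))).
    by apply: is_deriveZ; exact: is_derive_powR_subl.
  by rewrite addrK scalerN scaleNr opprK scalerA mulVf// scale1r.
rewrite (FTC2_is_derive uv _ dF); last first.
  move=> t /[!in_itv]/= /andP[ut tv]; apply: continuous_powR_subl.
  exact: le_lt_trans vb.
rewrite -EFinB; congr EFin; rewrite !fctE /= !scaleNr opprK addrC -scalerBr.
by rewrite mulrC.
Qed.

Lemma integral_inv_subl (R : realType) (b u v : R) :
  u < v < b ->
  (\int[@lebesgue_measure R]_(t in `[u, v]) ((b - t) `^ (-1))%:E =
   (ln (b - u) - ln (b - v))%:E)%E.
Proof.
move=> /andP[uv vb].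
have dF t : u <= t <= v ->
    is_derive t 1 (- (fun s => ln (b - s))) ((b - t) `^ (-1)).
  move=> /andP[ut tv]; have tb := le_lt_trans tv vb.
  rewrite powR_inv1 ?subr_ge0 1?ltW// -[X in is_derive _ _ _ X]opprK.
  by apply: is_deriveN; exact: is_derive_ln_subl.
rewrite (FTC2_is_derive uv _ dF); last first.
  move=> t /[!in_itv]/= /andP[ut tv]; apply: continuous_powR_subl.
  exact: le_lt_trans vb.
by rewrite -EFinB; congr EFin; rewrite !fctE opprK addrC.
Qed.

Lemma measurable_powR_subl (R : realType) (b beta : R) (D : set R) :
  measurable_fun D (fun t => (b - t) `^ beta).
Proof.
apply: (measurableT_comp (measurable_powR beta)).
exact: measurable_funB.
Qed.

(** Both directions rest on explicit primitives. For [beta > -1] the integral up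
    to [b - e] is at most [d ^ (beta + 1) / (beta + 1)], uniformly in [e]. For
    [beta <= -1] the bound [d <= 1] makes the integrand at least [1 / (b - t)],
    whose integral up to [b - e] is [ln (d / e)], which is unbounded. *)
Lemma integral_powR_subl_lty (R : realType) (b beta d : R) :
  0 < d -> d <= 1 ->
  (\int[@lebesgue_measure R]_(t in `[(b - d)%R, b[) ((b - t) `^ beta)%:E < +oo)%E
  <-> -1 < beta.
Proof.
move=> d0 d1; set mu := @lebesgue_measure R.
have mp r D : measurable_fun D (fun t : R => ((b - t) `^ r)%:E).
  by apply/measurable_EFinP; exact: measurable_powR_subl.
split=> [fin|b1].
  rewrite ltNge; apply/negP => b1.
  set I := (X in (X < _)%E) in fin.
  have I0 : (0 <= I)%E by apply: integral_ge0 => t _; rewrite lee_fin powR_ge0.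
  have Ifin : I \is a fin_num by rewrite ge0_fin_numE.
  (* the choice of [e] makes [ln (d / e)] exceed the alleged value [I] by 1 *)
  pose e := d * expR (- (fine I + 1)).
  have e0 : 0 < e by rewrite mulr_gt0// expR_gt0.
  have ed : e < d.
    by rewrite gtr_pMr// expR_lt1 oppr_lt0 ltr_wpDl// fine_ge0.
  have : ((fine I + 1)%:E <= I)%E.
    rewrite (_ : fine I + 1 = ln (b - (b - d)) - ln (b - (b - e))); last first.
      by rewrite !subKr /e lnM ?posrE// ?expR_gt0// expRK; ring.
    rewrite -integral_inv_subl; last first.
      by rewrite ltrD2l ltrN2 ed ltrBlDr ltrDl.
    apply: (@le_trans _ _ (\int[mu]_(t in `[(b - d)%R, (b - e)%R]) ((b - t) `^ beta)%:E)%E).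
      apply: ge0_le_integral => //.
      - by move=> t _; rewrite lee_fin powR_ge0.
      - exact: mp.
      - exact: mp.
      - move=> t/=; rewrite in_itv/= => /andP[ut tv]; rewrite lee_fin.
        apply: ger_powR => //; rewrite subr_gt0 (le_lt_trans tv)/=; first lra.
        by rewrite ltrBlDr ltrDl.
    apply: ge0_subset_integral => //.
    - exact: mp.
    - by move=> t _; rewrite lee_fin powR_ge0.
    - move=> t/=; rewrite !in_itv/= => /andP[-> /le_lt_trans]; apply.
      by rewrite ltrBlDr ltrDl.
  by rewrite -[X in (_ <= X)%E](fineK Ifin) lee_fin -subr_ge0 opprD addNKr oppr_ge0 ler10.
have b10 : 0 < beta + 1 by rewrite -ltrBlDr sub0r.
apply: (@le_lt_trans _ _ (d `^ (beta + 1) / (beta + 1))%:E); last exact: ltry.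
rewrite itv_bnd_open_bigcup.
set F := (X in bigcup _ X).
have cv : (\int[mu]_(t in F n) ((b - t) `^ beta)%:E @[n --> \oo] -->
    \int[mu]_(t in \bigcup_n F n) ((b - t) `^ beta)%:E)%E.
  apply: ge0_nondecreasing_set_cvg_integral => //.
  - move=> m n mn; apply/subsetPset => t; rewrite /F/= !in_itv/= => /andP[->/=].
    by move=> /le_trans; apply; rewrite lerD2l lerN2 lef_pV2 ?posrE// ler_nat.
  - by move=> n; exact: measurable_itv.
  - by move=> n; exact: mp.
  - by move=> n t _; rewrite lee_fin powR_ge0.
rewrite -(cvg_lim _ cv)//; apply: lime_le; first exact: cvgP cv.
apply: nearW => n; rewrite /F; have [dn|dn] := leP d n.+1%:R^-1.
  (* for small [n] the interval is empty or a point *)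
  rewrite (@integral_Sset1 _ _ _ (b - d)) => [|t/=].
    by rewrite lee_fin divr_ge0 ?powR_ge0// ltW.
  rewrite in_itv/= => /andP[dt tn]; apply/eqP; rewrite eq_le dt andbT.
  by apply: (le_trans tn); rewrite lerD2l lerN2.
rewrite integral_powR_subl; last by rewrite gt_eqF.
  by rewrite subKr lee_fin ler_pM2r ?invr_gt0// gerBl powR_ge0.
by rewrite ltrD2l ltrN2 dn/= ltrBlDr ltrDl invr_gt0.
Qed.

(** * The kernels and their integrals *)

(** The integrand of the T-transform is the case [k = 1], and that of minus its
    derivative the case [k = 2]. *)
Definition Tkernel (R : realType) (k : nat) (z t : R) : R := t / (z - t) ^+ k.

Lemma measurable_inv (R : realType) (D : set R) :
  measurable_fun D (fun x : R => x^-1).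
Proof.
(* [x `^ (-1)] is the inverse of [x] only for [x >= 0], hence the square *)
rewrite (_ : (fun _ => _) = (fun x : R => x * (x ^+ 2) `^ (-1))); last first.
  apply/funext => x; have [->|x0] := eqVneq x 0; first by rewrite invr0 mul0r.
  by rewrite powR_inv1 ?sqr_ge0//; field.
apply: measurable_funM => //.
by apply: (measurableT_comp (measurable_powR (-1))); exact: measurable_funX.
Qed.

Lemma measurable_Tkernel (R : realType) k (z : R) (D : set R) :
  measurable_fun D (Tkernel k z).
Proof.
apply: measurable_funM => //.
apply: (measurableT_comp (@measurable_inv R setT)) => //.
by apply: measurable_funX; exact: measurable_funB.
Qed.

Lemma measurable_EFin_Tkernel (R : realType) k (z : R) (D : set R) :
  measurable_fun D (fun t => (Tkernel k z t)%:E).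
Proof. by apply/measurable_EFinP; exact: measurable_Tkernel. Qed.

Lemma is_derive_Tkernel (R : realType) (z t : R) : t < z ->
  is_derive z 1 (Tkernel 1 ^~ t) (- Tkernel 2 z t).
Proof.
move=> tz; have zt0 : z - t != 0 by rewrite subr_eq0 gt_eqF.
have D : is_derive z 1 (fun y : R => y - t) 1.
  by rewrite -[X in is_derive _ _ _ X]subr0; apply: is_deriveB.
have := is_deriveZ t (@is_deriveV _ (fun y => y - t) _ _ _ zt0 D).
rewrite /Tkernel (_ : (t *: _ : R) = - (t / (z - t) ^+ 2)).
  by under [X in is_derive _ _ X _ -> _]eq_fun do rewrite /GRing.scale/= -[_ - t]expr1.
by rewrite /GRing.scale/= mulr1 mulrN.
Qed.

Lemma Tkernel_ge0 (R : realType) k (z t : R) : 0 <= t <= z -> 0 <= Tkernel k z t.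
Proof. by move=> /andP[t0 tz]; rewrite divr_ge0// exprn_ge0// subr_ge0. Qed.

Lemma le_Tkernel (R : realType) k (y z t : R) : 0 <= t < y -> y <= z ->
  Tkernel k z t <= Tkernel k y t.
Proof.
move=> /andP[t0 ty] yz; apply: ler_wpM2l => //.
have ty0 : 0 < y - t by rewrite subr_gt0.
have tz0 : 0 < z - t by rewrite subr_gt0 (lt_le_trans ty).
rewrite lef_pV2 ?posrE ?exprn_gt0// lerXn2r ?nnegrE ?(ltW ty0) ?(ltW tz0)//.
by rewrite lerD2r.
Qed.

Lemma Tkernel_ub (R : realType) k (b u z t : R) : 0 <= t -> t <= b -> t <= u -> u < z ->
  Tkernel k z t <= b / (z - u) ^+ k.
Proof.
move=> t0 tb tu uz; apply: ler_pM => //.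
  by rewrite invr_ge0 exprn_ge0// subr_ge0 (le_trans tu)// ltW.
have uz0 : 0 < z - u by rewrite subr_gt0.
have tz0 : 0 < z - t by rewrite subr_gt0 (le_lt_trans tu).
rewrite lef_pV2 ?posrE ?exprn_gt0// lerXn2r ?nnegrE ?(ltW uz0) ?(ltW tz0)//.
by rewrite lerD2l lerN2.
Qed.

Lemma integrable_Tkernel (R : realType)
    (mu : {finite_measure set (measurableTypeR R) -> \bar R}) (b : R) k (z : R) :
  b < z -> mu.-integrable `[0, b[ (EFin \o Tkernel k z).
Proof.
move=> bz; apply: measurable_bounded_integrable => //.
- by rewrite ltey_eq fin_num_measure.
- exact: measurable_Tkernel.
- exists (b / (z - b) ^+ k); split; first exact: num_real.
  move=> x xM t/=; rewrite in_itv/= => /andP[t0 tb].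
  rewrite ger0_norm ?Tkernel_ge0 ?t0//=; last by rewrite ltW// (lt_trans tb).
  apply: le_trans (ltW xM); apply: Tkernel_ub => //; exact: ltW.
Qed.

Lemma T_transformE (R : realType)
    (mu : {measure set (measurableTypeR R) -> \bar R}) (b z : R) :
  mu (~` `[0, b[) = 0%E ->
  T_transform mu z = \int[mu]_(t in `[0, b[) Tkernel 1 z t.
Proof.
move=> mu_conc.
have -> : T_transform mu z = \int[mu]_t Tkernel 1 z t.
  by apply: eq_Rintegral => t _; rewrite /Tkernel expr1.
rewrite /Rintegral; congr fine; rewrite [RHS]integral_mkcond.
have mT := @measurable_EFin_Tkernel R 1 z.
apply: ae_eq_integral => //.
- exact: mT.
- have := (measurable_restrictT (fun t => (Tkernel 1 z t)%:E) (measurable_itv `[0, b[)).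
  by move=> H; apply/H; exact: mT.
- exists (~` `[0, b[); split => //; first exact: measurableC.
  by apply: subsetC => t /= tD _; rewrite patchE mem_set.
Qed.

(** The derivative of the integrand is dominated by the constant
    [b / (w - b) ^ 2], uniformly in the parameter, as long as the latter stays
    beyond a point [w > b]. *)
Lemma T_transform_diff (R : realType)
    (mu : {finite_measure set (measurableTypeR R) -> \bar R}) (b z : R) :
  0 < b -> mu (~` `[0, b[) = 0%E -> b < z ->
  derivable (T_transform mu) z 1 /\
  derive1 (T_transform mu) z = - \int[mu]_(t in `[0, b[) Tkernel 2 z t.
Proof.
move=> b_gt0 mu_conc bz.
rewrite (_ : T_transform mu = fun y => \int[mu]_(t in `[0, b[) Tkernel 1 y t); last first.
  by apply/funext => y; exact: T_transformE mu_conc.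
pose w := (b + z) / 2.
have bw : b < w by rewrite /w; lra.
have wz : w < z by rewrite /w; lra.
have mD : measurable (`[0, b[%classic : set (measurableTypeR R)).
  exact: measurable_itv.
have zI : `]w, z + 1[%classic z by rewrite /= in_itv/= wz ltrDl ltr01.
have iT x : `]w, z + 1[%classic x -> mu.-integrable `[0, b[ (EFin \o Tkernel 1 x).
  rewrite /= in_itv/= => /andP[wx _]; apply: integrable_Tkernel.
  exact: lt_trans bw wx.
have dT x t : `]w, z + 1[%classic x -> `[0, b[%classic t ->
    is_derive x 1 (Tkernel 1 ^~ t) (- Tkernel 2 x t).
  rewrite /= !in_itv/= => /andP[wx _] /andP[_ tb]; apply: is_derive_Tkernel.
  exact: lt_trans tb (lt_trans bw wx).
have dT' x t : `]w, z + 1[%classic x -> `[0, b[%classic t ->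
    partial1of2 (Tkernel 1) x t = - Tkernel 2 x t.
  by move=> xw tD; rewrite partial1of2E; have dxt := dT x t xw tD; apply: derive_val.
pose M := b / (w - b) ^+ 2.
have M0 : 0 <= M by rewrite divr_ge0 ?sqr_ge0// ltW.
have iM : mu.-integrable `[0, b[ (EFin \o cst M).
  exact: (finite_measure_integrable_cst _ _ mD).
have dM x t : `]w, z + 1[%classic x -> `[0, b[%classic t ->
    `|partial1of2 (Tkernel 1) x t| <= M.
  move=> xw tD; rewrite dT'// normrN.
  move: xw tD; rewrite /= !in_itv/= => /andP[wx _] /andP[t0 tb].
  have tx : t < x by rewrite (lt_trans tb)// (lt_trans bw).
  rewrite ger0_norm; last by rewrite Tkernel_ge0// t0 ltW.
  apply: (@le_trans _ _ (Tkernel 2 w t)).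
    by apply: le_Tkernel; [rewrite t0 (lt_trans tb)|exact: ltW].
  by apply: Tkernel_ub => //; exact: ltW.
have dv x t : `]w, z + 1[%classic x -> `[0, b[%classic t ->
    derivable (Tkernel 1 ^~ t) x 1.
  by move=> xw tD; apply: ex_derive; exact: dT.
split; first exact: (derivable_under_integral mD zI iT dv (fun=> M0) iM dM).
rewrite [LHS](differentiation_under_integral mD zI iT dv (fun=> M0) iM dM).
transitivity (\int[mu]_(t in `[0, b[) (-1 * Tkernel 2 z t)).
  by apply: eq_Rintegral => t /[!inE] tD; rewrite mulN1r; exact: dT'.
by rewrite RintegralZl ?mulN1r//; exact: integrable_Tkernel.
Qed.

(** The integrals decrease in [z], hence have a limit in the extended reals as
    [z] decreases to [b]; monotone convergence along the sequence
    [b + 1 / (n + 1)] identifies it. *)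
Lemma cvg_integral_Tkernel (R : realType)
    (mu : {measure set (measurableTypeR R) -> \bar R}) (b : R) k :
  (\int[mu]_(t in `[0%R, b[) (Tkernel k z t)%:E @[z --> b^'+] -->
   \int[mu]_(t in `[0%R, b[) (Tkernel k b t)%:E)%E.
Proof.
pose S z := (\int[mu]_(t in `[0%R, b[) (Tkernel k z t)%:E)%E.
have mT z : measurable_fun `[0%R, b[ (fun t => (Tkernel k z t)%:E).
  exact: measurable_EFin_Tkernel.
have T0 z t : b <= z -> `[0, b[%classic t -> (0 <= (Tkernel k z t)%:E)%E.
  rewrite /= in_itv/= => bz /andP[t0 tb]; rewrite lee_fin Tkernel_ge0// t0/=.
  by rewrite ltW// (lt_le_trans tb).
have Sni : {in `]b, +oo[ &, nonincreasing_fun S}.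
  move=> x y; rewrite !in_itv/= !andbT => bx by_ xy.
  apply: ge0_le_integral => //.
  - by move=> t; apply: T0; exact: ltW.
  - exact: mT.
  - exact: mT.
  - move=> t; rewrite /= in_itv/= => /andP[t0 tb]; rewrite lee_fin le_Tkernel// t0/=.
    exact: lt_trans bx.
have cS := nonincreasing_at_right_cvge (BInfty _ false) isT Sni.
set l := ereal_sup _ in cS.
pose u n : R := b + n.+1%:R^-1.
have ub n : b < u n by rewrite /u ltrDl.
have ucb : u n @[n --> \oo] --> b.
  rewrite -[X in _ --> X]addr0; rewrite /u.
  apply: cvgD; first exact: cvg_cst.
  by apply: cvg_harmonic.
have uc : u n @[n --> \oo] --> b^'+.
  move=> P bP; have : \forall n \near \oo, b < u n -> P (u n) by exact: ucb bP.
  by apply: filterS => n; apply.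
have Su : S (u n) @[n --> \oo] --> l by exact: cvg_comp uc cS.
suff Sb : S (u n) @[n --> \oo] --> S b.
  by rewrite -/(S b) (cvg_unique _ Sb Su).
rewrite {2}/S (_ : (\int[mu]_(t in `[0%R, b[) (Tkernel k b t)%:E)%E =
   (\int[mu]_(t in `[0%R, b[) limn (fun n => (Tkernel k (u n) t)%:E))%E); last first.
  apply: eq_integral => t; rewrite inE/= in_itv/= => /andP[t0 tb].
  have bt0 : (b - t) ^+ k != 0 by rewrite expf_neq0// subr_eq0 gt_eqF.
  have cB : u n - t @[n --> \oo] --> b - t by apply: cvgB => //; exact: cvg_cst.
  have cX : (u n - t) ^+ k @[n --> \oo] --> (b - t) ^+ k.
    exact: (cvg_comp _ (fun y : R => y ^+ k) cB (@exprn_continuous R k (b - t))).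
  have cT : Tkernel k (u n) t @[n --> \oo] --> Tkernel k b t.
    by apply: cvgM; [exact: cvg_cst|exact: cvgV].
  apply/esym/cvg_lim => //; exact: cvg_EFin (nearW _ _) cT.
apply: cvg_monotone_convergence => //.
- by move=> n; exact: mT.
- by move=> n t tD; apply: T0 => //; exact: ltW.
- move=> t tD m n mn; rewrite lee_fin.
  move: tD; rewrite /= in_itv/= => /andP[t0 tb]; apply: le_Tkernel.
    by rewrite t0 (lt_trans tb).
  by rewrite lerD2l lef_pV2 ?posrE// ler_nat.
Qed.

(** * Behaviour at the right end of the support *)

Lemma decay_sandwich (R : realType) (f : R -> R) (b alpha c m : R) :
  0 < c -> 0 < m ->
  f t / (c * (b - t) `^ alpha) @[t --> b^'-] --> (1 : R) ->
  exists d, [/\ 0 < d, d <= m & forall t, b - d <= t < b ->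
    c / 2 * (b - t) `^ alpha <= f t <= 2 * c * (b - t) `^ alpha].
Proof.
move=> c0 m0 /cvgrPdist_lt/(_ (1 / 2)) /(_ ltac:(lra)) [e /= e0 fe].
exists (Num.min (e / 2) m); split.
- by rewrite lt_min m0 andbT divr_gt0.
- by rewrite ge_min lexx orbT.
move=> t /andP[dt tb].
have pt : 0 < c * (b - t) `^ alpha by rewrite mulr_gt0// powR_gt0// subr_gt0.
have /fe : `|b - t| < e.
  rewrite gtr0_norm ?subr_gt0// ltrBlDr.
  have : Num.min (e / 2) m <= e / 2 by rewrite ge_min lexx.
  by lra.
move=> /(_ tb); rewrite ltr_distlC => /andP[].
rewrite ltr_pdivlMr// ltr_pdivrMr// => f1 f2.
by apply/andP; split; lra.
Qed.

(** Otherwise [f] would be positive on some [(b - d, b)] contained in the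
    negative half-line, which [mu] does not charge. *)
Lemma gt0_of_decay (R : realType) (mu : {measure set (measurableTypeR R) -> \bar R})
    (f : R -> R) (b alpha c : R) :
  mu `]-oo, (0 : R)[%classic = 0%E -> has_density mu f -> 0 < c ->
  f t / (c * (b - t) `^ alpha) @[t --> b^'-] --> (1 : R) ->
  0 < b.
Proof.
move=> mu0 [mf f0 muf] c0 /(decay_sandwich c0 (@ltr01 R))[d [d0 _ fd]].
rewrite ltNge; apply/negP => b0.
pose A : set (measurableTypeR R) := `](b - d), b[%classic.
have mA : measurable A by exact: measurable_itv.
have muA : mu A = 0%E.
  apply/eqP; rewrite -measure_le0 -mu0; apply: le_measure; rewrite ?inE//.
  by move=> t; rewrite /A/= !in_itv/= => /andP[_ /lt_le_trans]; exact.
have mfA : measurable_fun A (EFin \o f).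
  by apply/measurable_EFinP; exact: measurable_funTS.
move: muA; rewrite muf// => muA.
have /(ae_eq_integral_abs _ mA mfA)[N [mN N0 AN]] :
    (\int[@lebesgue_measure R]_(t in A) `|(EFin \o f) t| = 0)%E.
  by rewrite -[RHS]muA; apply: eq_integral => t _; rewrite gee0_abs// lee_fin.
have : (@lebesgue_measure R A <= lebesgue_measure N)%E.
  apply: le_measure; rewrite ?inE// => t At; apply: AN => /= /(_ At)[ft0].
  move: At; rewrite /A/= in_itv/= => /andP[dt tb].
  have := fd t; rewrite ft0 (ltW dt) tb => /(_ isT)/andP[+ _].
  by apply/negP; rewrite -ltNge mulr_gt0 ?divr_gt0// powR_gt0// subr_gt0.
rewrite N0 /A lebesgue_measure_itv/= lte_fin ltrBlDr ltrDl d0 -EFinB lee_fin.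
by apply/negP; rewrite -ltNge; lra.
Qed.

Lemma measure_setC_itv0b (R : realType)
    (mu : {measure set (measurableTypeR R) -> \bar R}) (f : R -> R) (b : R) :
  mu `]-oo, (0 : R)[%classic = 0%E -> mu `]b, +oo[%classic = 0%E ->
  has_density mu f -> mu (~` `[0, b[) = 0%E.
Proof.
move=> mu0 mub fd.
have mub1 : mu [set b] = 0%E.
  have /null_content_dominatesP := density_dominates fd; apply => //.
  exact: lebesgue_measure_set1.
have mI (i : interval R) : measurable ([set` i] : set (measurableTypeR R)).
  exact: measurable_itv.
apply/negligibleP; first exact: measurableC.
pose N : set (measurableTypeR R) := `]-oo, 0[ `|` ([set b] `|` `]b, +oo[).
apply: (@negligibleS _ _ _ _ N).
  move=> t; rewrite /N/= !in_itv/= andbT => /negP; rewrite negb_and -ltNge -leNgt.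
  by move=> /orP[|]; [left|rewrite le_eqVlt => /predU1P[->|]; right; [left|right]].
apply: negligibleU; first by apply/negligibleP.
by apply: negligibleU; apply/negligibleP.
Qed.

(** On [[0, b - d[] the integrand is bounded. On [[b - d, b[] the integral lies
    between positive multiples of the Lebesgue integral [P] of
    [(b - t) ^ (alpha - k)]; the condition [d <= b / 2] keeps the factor [t]
    of the integrand away from 0. *)
Lemma integral_Tkernel_lty (R : realType)
    (mu : {finite_measure set (measurableTypeR R) -> \bar R}) (f : R -> R) (b alpha c : R) k :
  0 < b -> has_density mu f -> 0 < c ->
  f t / (c * (b - t) `^ alpha) @[t --> b^'-] --> (1 : R) ->
  (\int[mu]_(t in `[0%R, b[) (Tkernel k b t)%:E < +oo)%E <-> k%:R < alpha + 1.
Proof.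
move=> b0 fd c0 fdec.
have m0 : 0 < Num.min 1 (b / 2) by rewrite lt_min ltr01 divr_gt0.
have [d [d0 dm fsand]] := decay_sandwich c0 m0 fdec.
have [d1 db] : d <= 1 /\ d <= b / 2 by move: dm; rewrite le_min => /andP[].
have [mf f0 _] := fd.
pose A : set (measurableTypeR R) := `[0, (b - d)[%classic.
pose B : set (measurableTypeR R) := `[(b - d), b[%classic.
have mA : measurable A by exact: measurable_itv.
have mB : measurable B by exact: measurable_itv.
have mT := @measurable_EFin_Tkernel R k b.
have T0 t : `[0, b[%classic t -> (0 <= (Tkernel k b t)%:E)%E.
  by rewrite /= in_itv/= => /andP[t0 tb]; rewrite lee_fin Tkernel_ge0// t0 ltW.
have ABE : `[0, b[%classic = A `|` B.
  by rewrite -itv_bndbnd_setU// bnd_simp; lra.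
have AD : A `<=` `[0, b[ by rewrite ABE; exact: subsetUl.
have BD : B `<=` `[0, b[ by rewrite ABE; exact: subsetUr.
have intA : (\int[mu]_(t in A) (Tkernel k b t)%:E < +oo)%E.
  apply: (@le_lt_trans _ _ (\int[mu]_(t in A) (cst (b / d ^+ k)%:E) t)%E).
    apply: ge0_le_integral => //.
    - by move=> t /AD; exact: T0.
    - exact: mT.
    - move=> t; rewrite /A/= in_itv/= => /andP[t0 tb]; rewrite lee_fin.
      have := @Tkernel_ub R k b (b - d) b t t0; rewrite subKr; apply; lra.
  rewrite integral_cst//; apply: lte_mul_pinfty => //.
    by rewrite lee_fin divr_ge0 ?exprn_ge0 ?ltW.
  by rewrite ltey_eq fin_num_measure.
pose P := (\int[@lebesgue_measure R]_(t in B) ((b - t) `^ (alpha - k%:R))%:E)%E.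
have P0 : (0 <= P)%E by apply: integral_ge0 => t _; rewrite lee_fin powR_ge0.
have mP : measurable_fun B (fun t => ((b - t) `^ (alpha - k%:R))%:E).
  by apply/measurable_EFinP; exact: measurable_powR_subl.
have mTf : measurable_fun B (fun t => (Tkernel k b t)%:E * (f t)%:E)%E.
  apply: emeasurable_funM; first exact: mT.
  by apply/measurable_EFinP; exact: measurable_funTS.
have powE t : t < b -> (b - t) `^ (alpha - k%:R) = (b - t) `^ alpha / (b - t) ^+ k.
  move=> tb; have bt0 : 0 < b - t by rewrite subr_gt0.
  by rewrite powRB ?powR_mulrn ?(ltW bt0)// (gt_eqF bt0) implybT.
have intB : (\int[mu]_(t in B) (Tkernel k b t)%:E =
    \int[@lebesgue_measure R]_(t in B) ((Tkernel k b t)%:E * (f t)%:E))%E.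
  apply: ge0_integral_density => //; first exact: mT.
  by move=> t /BD; exact: T0.
have lo : ((b / 2 * (c / 2))%:E * P <= \int[mu]_(t in B) (Tkernel k b t)%:E)%E.
  rewrite intB -ge0_integralZl//; last 2 first.
  - by move=> t _; rewrite lee_fin powR_ge0.
  - by rewrite lee_fin !mulr_ge0 ?ltW.
  apply: ge0_le_integral => //.
  - by move=> t _; rewrite -EFinM lee_fin mulr_ge0 ?powR_ge0// !mulr_ge0 ?ltW.
  - exact: measurable_funeM.
  - move=> t; rewrite /B/= in_itv/= => /andP[dt tb].
    have := fsand t; rewrite dt tb => /(_ isT)/andP[fl _].
    rewrite -!EFinM lee_fin powE// /Tkernel [leLHS]mulrA [leRHS]mulrAC ler_pM2r; last first.
      by rewrite invr_gt0 exprn_gt0// subr_gt0.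
    rewrite -[leLHS]mulrA; apply: ler_pM => //; last by lra.
    - by rewrite divr_ge0// ltW.
    - by rewrite mulr_ge0 ?powR_ge0// divr_ge0// ltW.
have up : (\int[mu]_(t in B) (Tkernel k b t)%:E <= (b * (2 * c))%:E * P)%E.
  rewrite intB -ge0_integralZl//; last 2 first.
  - by move=> t _; rewrite lee_fin powR_ge0.
  - by rewrite lee_fin !mulr_ge0 ?ltW.
  apply: ge0_le_integral => //.
  - by move=> t tB; rewrite mule_ge0 ?lee_fin//; exact/T0/BD.
  - exact: measurable_funeM.
  - move=> t; rewrite /B/= in_itv/= => /andP[dt tb].
    have := fsand t; rewrite dt tb => /(_ isT)/andP[_ fu].
    rewrite -!EFinM lee_fin powE// /Tkernel [leRHS]mulrA [leLHS]mulrAC ler_pM2r; last first.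
      by rewrite invr_gt0 exprn_gt0// subr_gt0.
    rewrite -[leRHS]mulrA; apply: ler_pM => //; [lra|exact: ltW].
rewrite ABE ge0_integral_setU//; last 3 first.
- exact: mT.
- by move=> t; rewrite -ABE; exact: T0.
- apply/disj_setPS => t [At Bt]; move: At Bt.
  rewrite /A /B/= !in_itv/= => /andP[_ td] /andP[dt _].
  by move: (lt_le_trans td dt); rewrite ltxx.
rewrite (_ : (k%:R < alpha + 1) = (-1 < alpha - k%:R)); last first.
  by apply/idP/idP; lra.
rewrite -(integral_powR_subl_lty b (alpha - k%:R) d0 d1) -/B -/P; split => [fin|fin].
- have {}fin : ((b / 2 * (c / 2))%:E * P < +oo)%E.
    apply: le_lt_trans lo (le_lt_trans _ fin).
    by rewrite leeDr// integral_ge0// => t /AD; exact: T0.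
  rewrite ltNge leye_eq; apply/negP => /eqP Poo; move: fin; rewrite Poo.
  by rewrite gt0_muley ?ltxx// lte_fin !mulr_gt0 ?divr_gt0.
- apply: lte_add_pinfty => //; apply: le_lt_trans up _.
  by apply: lte_mul_pinfty => //; rewrite lee_fin !mulr_ge0 ?ltW.
Qed.

Theorem proposition2p9 (R : realType) (mu : probability (measurableTypeR R) R)
    (f : R -> R) (b alpha c : R)
    (mu_nneg : mu `]-oo, (0 : R)[%classic = 0%E)
    (mu_compact : compact (msupport mu))
    (mu_not_dirac0 : ~ (forall A : set (measurableTypeR R), measurable A ->
                          mu A = \d_(0 : measurableTypeR R) A))
    (b_def : b = sup (msupport mu))
    (f_density : has_density mu f)
    (alpha_gtN1 : -1 < alpha)
    (c_gt0 : 0 < c)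
    (f_decay : f t / (c * (b - t) `^ alpha) @[t --> b^'-] --> (1 : R)) :
  [/\ (forall z, b < z -> derivable (T_transform mu) z 1),
      has_right_lim (T_transform mu) b /\
      has_right_lim (derive1 (T_transform mu)) b,
      ((right_lim (T_transform mu) b < +oo)%E <-> 0 < alpha),
      (right_lim (derive1 (T_transform mu)) b = -oo%E <-> alpha <= 1) &
      (alpha = 1 / 2 ->
         (right_lim (T_transform mu) b < +oo)%E /\
         right_lim (derive1 (T_transform mu)) b = -oo%E)].
Proof.
have b_gt0 := gt0_of_decay mu_nneg f_density c_gt0 f_decay.
have mu_gtb : mu `]b, +oo[%classic = 0%E.
  by rewrite b_def; exact: measure_gt_sup_msupport.
have mu_conc := measure_setC_itv0b mu_nneg mu_gtb f_density.
have lty k := integral_Tkernel_lty k b_gt0 f_density c_gt0 f_decay.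
pose S k := (\int[mu]_(t in `[0%R, b[) (Tkernel k b t)%:E)%E.
have right_near (g h : R -> \bar R) l : (forall z, b < z -> g z = h z) ->
    h z @[z --> b^'+] --> l -> g z @[z --> b^'+] --> l.
  move=> gh; apply: cvg_trans; apply: near_eq_cvg.
  by near=> z; apply/esym/gh; near: z; exact: nbhs_right_gt.
have finS k z : b < z -> (\int[mu]_(t in `[0%R, b[) Tkernel k z t)%:E =
    (\int[mu]_(t in `[0%R, b[) (Tkernel k z t)%:E)%E.
  move=> bz; rewrite /Rintegral fineK//; apply: integrable_fin_num => //.
  exact: integrable_Tkernel.
have cT : (T_transform mu z)%:E @[z --> b^'+] --> S 1%N.
  apply: right_near (@cvg_integral_Tkernel R mu b 1%N) => z bz.
  by rewrite (T_transformE _ mu_conc) finS.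
have cT' : (derive1 (T_transform mu) z)%:E @[z --> b^'+] --> (- S 2%N)%E.
  apply: right_near (cvgeN (@cvg_integral_Tkernel R mu b 2%N)) => z bz.
  by rewrite (T_transform_diff b_gt0 mu_conc bz).2 EFinN finS.
have limT : right_lim (T_transform mu) b = S 1%N by exact/cvg_lim.
have limT' : right_lim (derive1 (T_transform mu)) b = (- S 2%N)%E by exact/cvg_lim.
have fin_iff : (right_lim (T_transform mu) b < +oo)%E <-> 0 < alpha.
  by rewrite limT lty; split; lra.
have inf_iff : right_lim (derive1 (T_transform mu)) b = -oo%E <-> alpha <= 1.
  rewrite limT'; split=> [/eqP|a1].
    rewrite eqe_oppLR /= => /eqP S2; rewrite leNgt; apply/negP => a1.
    have : (S 2%N < +oo)%E by apply/lty; lra.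
    by rewrite S2 ltxx.
  apply/eqP; rewrite eqe_oppLR/= -leye_eq leNgt; apply/negP => /lty.
  lra.
split=> //.
- by move=> z bz; exact: (T_transform_diff b_gt0 mu_conc bz).1.
- by split; [exact: cvgP cT|exact: cvgP cT'].
- by move=> a12; split; [apply/fin_iff; lra|apply/inf_iff; lra].
Unshelve. all: by end_near. Qed.
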